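(* Let $(P,\le,0,1)$ be a complemented poset of finite length. If $U\Big(x^+,L\big(x,U(x^+,y)\big)\Big)\subseteq U(y)$ for all $x,y\in P$, then for all $x,y,z\in P$, $x\odot y\le z$ implies $x\le y\hookrightarrow z$. If $L\Big(x,U\big(x^+,L(x,y)\big)\Big)\subseteq L(y)$ for all $x,y\in P$, then for all $x,y,z\in P$, $x\le y\hookrightarrow z$ implies $x\odot y\le z$.
   Context: $(P,\le,0,1)$ is a bounded poset with $0\ne1$, complemented (every element has a complement $b$ with $a\vee b=1$, $a\wedge b=0$), of finite length (no infinite chains). $x^+$ denotes the set of all complements of $x$. $\mathrm{Max}\,A$, $\mathrm{Min}\,A$ are the sets of maximal, minimal elements of $A$; $L(A)$, $U(A)$ the sets of lower, upper bounds, with $L(A,B):=L(A\cup B)$ etc. Define $a\odot b:=\mathrm{Max}\,L\big(b,U(a,b^+)\big)$ and $a\hookrightarrow b:=\mathrm{Min}\,U\big(a^+,L(a,b)\big)$. For sets, $A\le B$ means $x\le y$ for all $x\in A$, $y\in B$ (singletons identified with elements). *)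

(* Defs.v *)
From HB Require Import structures.
From mathcomp Require Import all_boot all_order.
From mathcomp Require Import boolp classical_sets functions cardinality.

Set Implicit Arguments.
Unset Strict Implicit.
Unset Printing Implicit Defensive.

Import Order.TTheory.
Local Open Scope classical_set_scope.
Local Open Scope order_scope.

Section ComplementedPoset.
Context {d : Order.disp_t} {P : tbPOrderType d}.
Implicit Types (a b : P) (A B : set P).

(* The joins and meets of a mere poset are partial: [a \/ b = 1] means that the
   supremum of [a] and [b] exists and is [\top], and dually for meets. *)
Definition complements a : set P :=
  [set b | supremums [set a; b] \top /\ infimums [set a; b] \bot].

Definition Max A : set P := [set a | A a /\ forall b, A b -> a <= b -> b = a].

Definition Min A : set P := [set a | A a /\ forall b, A b -> b <= a -> b = a].

Definition odot a b : set P :=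
  Max (lbound ([set b] `|` ubound ([set a] `|` complements b))).

Definition hook a b : set P :=
  Min (ubound (complements a `|` lbound [set a; b])).

Definition set_le A B : Prop := forall x y, A x -> B y -> x <= y.

End ComplementedPoset.

Definition complemented (d : Order.disp_t) (P : tbPOrderType d) : Prop :=
  forall a : P, complements a !=set0.

Definition finite_length (d : Order.disp_t) (P : porderType d) : Prop :=
  forall C : set P, total_on C (fun x y => x <= y) -> finite_set C.

(* Main.v *)
(* In a poset of finite length every element of a set lies below a maximal and
   above a minimal element of it. Hence $x \odot y \le z$ says that
   [L(y, U(x, y^+))] is contained in [L(z)], thus in [L(y, z)], and
   $x \le y \hookrightarrow z$ says that [U(y^+, L(y, z))] is contained in [U(x)], thus in
   [U(x, y^+)]. Since [U] and [L] are antitone, the two hypotheses, taken at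
   [(y, x)] and [(y, z)], give the two implications. *)
Require Import Defs.
From HB Require Import structures.
From mathcomp Require Import all_boot all_order.
From mathcomp Require Import boolp classical_sets functions cardinality.

Set Implicit Arguments.
Unset Strict Implicit.
Unset Printing Implicit Defensive.

Import Order.TTheory.
Local Open Scope classical_set_scope.
Local Open Scope order_scope.

(** Induction on a list enumerating the chain: its greatest element is the larger of the head and
    the greatest element of the tail. *)
Lemma finite_chain_greatest (d : Order.disp_t) (P : porderType d) (C : set P) :
  finite_set C -> total_on C (fun x y => x <= y) -> C !=set0 ->
  exists2 m, C m & ubound C m.
Proof.
move=> /finite_seqP[s ->] + [a /= a_s].
case: s a_s => // b s _; elim: s b => [|c s IHs] b tot_s.
  by exists b; [rewrite /= mem_head | move=> x /=; rewrite inE => /eqP ->].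
have [|m ms m_ub] := IHs c.
  by move=> x y /= xs ys; apply: tot_s; rewrite /= inE (xs, ys) orbT.
have [||bm|mb] := tot_s b m; first exact: mem_head.
- by rewrite /= inE ms orbT.
- exists m; first by rewrite /= inE ms orbT.
  by move=> x /=; rewrite inE => /predU1P[->//|]; exact: m_ub.
- exists b; first exact: mem_head.
  move=> x /=; rewrite inE => /predU1P[->//|xs].
  exact: le_trans (m_ub x xs) mb.
Qed.

(** Zorn's lemma on the elements of [A] above [a]: chains there are finite, so a nonempty one is
    bounded by its greatest element. *)
Lemma Max_above (d : Order.disp_t) (P : tbPOrderType d) (A : set P) (a : P) :
  finite_length P -> A a -> exists2 m, Max A m & a <= m.
Proof.
move=> fin_P Aa; pose T := {b : P | A b /\ a <= b}.
pose a0 : T := exist _ a (conj Aa (lexx a)).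
pose R (x y : T) := sval x <= sval y.
have [x|y x z xy yz|C C_tot|[m [Am am]] m_max] := @ZL_preorder T a0 R.
- exact: lexx.
- exact: le_trans xy yz.
(* The empty chain has no greatest element; [a0] bounds it. *)
- have [->|C0] := eqVneq C set0; first by exists a0.
  have tot_C : total_on (sval @` C) (fun x y => x <= y).
    by move=> _ _ [x Cx <-] [y Cy <-]; exact: C_tot.
  have [|_ [m Cm <-] m_ub] := finite_chain_greatest (fin_P _ tot_C) tot_C.
    by have /set0P[x Cx] := C0; exists (sval x); exists x.
  by exists m => x Cx; apply: m_ub; exists x.
(* Zorn for preorders yields only [b <= m]; antisymmetry turns this into equality. *)
- exists m => //; split=> // b Ab mb; apply: le_anti; rewrite mb andbT.
  exact: (m_max (exist _ b (conj Ab (le_trans am mb))) mb).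
Qed.

Lemma finite_length_dual (d : Order.disp_t) (P : porderType d) :
  finite_length P -> finite_length P^d.
Proof.
move=> fin_P C C_tot; apply: fin_P => x y Cx Cy.
by have [xy|yx] := C_tot x y Cx Cy; [right | left].
Qed.

Lemma Min_below (d : Order.disp_t) (P : tbPOrderType d) (A : set P) (a : P) :
  finite_length P -> A a -> exists2 m, Min A m & m <= a.
Proof. by move=> /finite_length_dual fin_P; exact: (@Max_above _ P^d). Qed.

Theorem theorem4p12 (d : Order.disp_t) (P : tbPOrderType d)
  (P_nontrivial : (\bot : P) <> \top)
  (P_complemented : complemented P)
  (P_finite_length : finite_length P) :
  ((forall x y : P,
      ubound (complements x `|`
              lbound ([set x] `|` ubound (complements x `|` [set y])))
        `<=` ubound [set y]) ->
    forall x y z : P,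
      set_le (odot x y) [set z] -> set_le [set x] (hook y z)) /\
  ((forall x y : P,
      lbound ([set x] `|` ubound (complements x `|` lbound [set x; y]))
        `<=` lbound [set y]) ->
    forall x y z : P,
      set_le [set x] (hook y z) -> set_le (odot x y) [set z]).
Proof.
split=> [H x y z xyz _ w -> [w_ub _]|H x y z xyz w _ [w_lb _] ->].
- have lbz v : lbound ([set y] `|` ubound ([set x] `|` complements y)) v ->
      v <= z.
    move=> /(Max_above P_finite_length)[m m_max vm].
    exact: le_trans vm (xyz _ _ m_max erefl).
  (* For [v] in the inner lower cone, it remains to see that [v] is below both [y] and [z]. *)
  apply: (H y x w) => // v [yv|v_lb]; apply: w_ub; [by left | right].
  rewrite setUC in v_lb.
  move=> _ [->|->]; first by apply: v_lb; right.
  by apply: lbz; rewrite setUC (setUC [set x]).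
- have xub v : ubound (complements y `|` lbound [set y; z]) v -> x <= v.
    move=> /(Min_below P_finite_length)[m m_min mv].
    exact: le_trans (xyz _ _ erefl m_min) mv.
  (* Dually, [v] in the inner upper cone must bound [x] and all complements of [y]. *)
  apply: (H y z w) => // v [->|v_ub]; apply: w_lb; [by left | right].
  move=> u [->|yu]; first exact: xub.
  by apply: v_ub; left.
Qed.
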